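(* Let $\mathcal O_1,\mathcal O_2\subset\mathfrak{gl}(n,\mathbb C)$ be two semisimple adjoint orbits of $GL(n,\mathbb C)$, where $\mathcal O_i$ ($i=1,2$) has exactly two different eigenvalues $\mu_i,-\mu_i$, with multiplicities $k_i$ and $l_i$ respectively ($k_i+l_i=n$). Put $d_i=k_i-l_i$. If $|d_1|+|d_2|>2$, then the variety $$\{(A,B)\in\mathcal O_1\times\mathcal O_2;\ A+B\in\mathcal S_n\}$$ is empty.
   Context: $\mathcal S_n$ is the set of $n\times n$ companion matrices, i.e. complex matrices with all subdiagonal entries equal to $1$, arbitrary last column $(s_n,s_{n-1},\dots,s_1)^T$, and all other entries equal to zero. *)

(* Defs.v *)
From mathcomp Require Import all_boot all_order all_algebra.
From mathcomp Require Import complex.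
From mathcomp Require Import all_classical reals.

Set Implicit Arguments.
Unset Strict Implicit.
Unset Printing Implicit Defensive.

Import GRing.Theory Num.Theory.
Local Open Scope ring_scope.
Local Open Scope classical_set_scope.

Definition adjoint_orbit (F : fieldType) (n : nat) (X : 'M[F]_n) : set 'M[F]_n :=
  [set P *m X *m invmx P | P in [set P | P \in unitmx]].

(* Semisimple is rendered as diagonalizable, which is its meaning over an
   algebraically closed field; F is only instantiated with R[i]. *)
Definition semisimple_orbit (F : fieldType) (n : nat) (O : set 'M[F]_n) : Prop :=
  exists2 X : 'M[F]_n, diagonalizable X & O = adjoint_orbit X.

Definition has_spectrum2 (F : fieldType) (n : nat) (O : set 'M[F]_n)
    (a b : F) (k l : nat) : Prop :=
  a != b /\
  forall A : 'M[F]_n, O A ->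
    [/\ forall c : F, eigenvalue A c = (c \in [:: a; b]),
        mup a (char_poly A) = k & mup b (char_poly A) = l].

(* With 0-based indices i, j the entry s_{n-i} sits in row i of the last
   column, so the column reads s_n, ..., s_1 from top to bottom; only the
   values s 1, ..., s n matter. *)
Definition companion_mx (F : fieldType) (n : nat) (s : nat -> F) : 'M[F]_n :=
  \matrix_(i < n, j < n)
    if j.+1 == n then s (n - i)%N else if i == j.+1 :> nat then 1 else 0.

Definition companion_set (F : fieldType) (n : nat) : set 'M[F]_n :=
  range (@companion_mx F n).

(* Main.v *)
Require Import Defs.
From mathcomp Require Import all_boot all_order all_algebra.
From mathcomp Require Import complex.
From mathcomp Require Import all_classical reals.
From mathcomp Require Import zify.

Set Implicit Arguments.
Unset Strict Implicit.
Unset Printing Implicit Defensive.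

Import GRing.Theory Num.Theory.
Local Open Scope ring_scope.
Local Open Scope classical_set_scope.

(** The idea is to force the sum A + B to have a two-dimensional eigenspace,
    which a companion matrix cannot have.  Put m1 = max(k1, l1) and
    m2 = max(k2, l2).  Diagonalizability turns multiplicities of eigenvalues
    into dimensions of eigenspaces ([mup_char_poly_le_rank_eigenspace]), so A
    has an eigenspace of dimension at least m1 and B one of dimension at least
    m2.  Inside a space of dimension n these two meet in dimension at least
        m1 + m2 - n = (|d1| + |d2|) / 2 > 1,
    and their intersection consists of eigenvectors of A + B for the sum of
    the two eigenvalues ([rank_eigenspaceD]).  On the other hand, an
    eigenvector of a companion matrix is determined by its first coordinate
    ([rank_eigenspace_companion]).

    Eigenspaces are spaces of row vectors throughout, so vectors are
    multiplied by matrices from the right. *)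

Lemma char_poly_conj (F : fieldType) (n : nat) (P X : 'M[F]_n) :
  P \in unitmx -> char_poly (P *m X *m invmx P) = char_poly X.
Proof.
move=> Pu; rewrite /char_poly.
have PV : map_mx polyC P *m map_mx polyC (invmx P) = 1%:M.
  by rewrite -map_mxM mulmxV // map_mx1.
have -> : char_poly_mx (P *m X *m invmx P)
    = map_mx polyC P *m char_poly_mx X *m map_mx polyC (invmx P).
  rewrite /char_poly_mx mulmxBr mulmxBl !map_mxM; congr (_ - _).
  by rewrite scalar_mxC -mulmxA PV mulmx1.
by rewrite !det_mulmx mulrAC -det_mulmx PV det1 mul1r.
Qed.

Lemma rank_conj (F : fieldType) (n : nat) (P X : 'M[F]_n) :
  P \in unitmx -> \rank (P *m X *m invmx P) = \rank X.
Proof.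
move=> Pu; rewrite mxrankMfree ?row_free_unit ?unitmx_inv //.
by rewrite eqmxMfull // row_full_unit.
Qed.

Lemma rank_diag_mx_le (F : fieldType) (n : nat) (d : 'rV[F]_n) :
  (\rank (diag_mx d) <= \sum_i (d 0 i != 0)%R)%N.
Proof.
rewrite diag_mx_sum_delta.
elim/big_rec2: _ => [|i r D _ IH]; first by rewrite mxrank0.
apply: leq_trans (mxrank_add _ _) (leq_add _ IH).
case: eqVneq => [->|_]; first by rewrite scale0r mxrank0.
by apply: leq_trans (mxrank_scale _ _) _; rewrite mxrank_delta.
Qed.

Lemma mup_char_poly_diag (F : fieldType) (n : nat) (d : 'rV[F]_n) (a : F) :
  mup a (char_poly (diag_mx d)) = (\sum_i (d 0%R i == a))%N.
Proof.
rewrite char_poly_trig ?diag_mx_is_trig //.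
rewrite (eq_bigr (fun i => 'X - (d 0 i)%:P)) => [|i _]; last first.
  by rewrite mxE eqxx mulr1n.
rewrite -(big_map (d 0) xpredT (fun x => 'X - x%:P)) mu_prod_XsubC count_map.
by rewrite -sum1_count big_mkcond /=; apply: eq_bigr => i _; case: eqP.
Qed.

(** In a basis of eigenvectors, the rank of A - a counts the diagonal entries
    different from a, while the exponent of X - a in the characteristic
    polynomial counts the entries equal to a. *)
Lemma mup_char_poly_le_rank_eigenspace (F : fieldType) (n : nat)
    (A : 'M[F]_n) (a : F) :
  diagonalizable A -> (mup a (char_poly A) <= \rank (eigenspace A a))%N.
Proof.
case=> P Pu /(similar_diagLR Pu)[d ->]; rewrite conjumx ?unitmx_inv //.
set Q := invmx P; have Qu : Q \in unitmx by rewrite unitmx_inv.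
rewrite char_poly_conj // mup_char_poly_diag /eigenspace mxrank_ker.
have -> : Q *m diag_mx d *m invmx Q - a%:M
    = Q *m diag_mx (d - const_mx a) *m invmx Q.
  rewrite linearB /= diag_const_mx mulmxBr mulmxBl; congr (_ - _).
  by rewrite scalar_mxC mulmxK.
rewrite rank_conj //.
have := rank_diag_mx_le (d - const_mx a).
under eq_bigr do rewrite !mxE subr_eq0.
have count_split : (\sum_i (d 0 i == a)%R + \sum_i (d 0 i != a)%R = n)%N.
  rewrite -big_split -[RHS]card_ord -sum1_card.
  by apply: eq_bigr => i _; case: eqP.
move=> rank_le; rewrite leq_subRL ?rank_leq_row // addnC.
by apply: leq_trans (eq_leq count_split); rewrite leq_add2l.
Qed.

Lemma rank_eigenspaceD (F : fieldType) (n : nat) (A B : 'M[F]_n) (a b : F) :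
  (\rank (eigenspace A a) + \rank (eigenspace B b)
     <= n + \rank (eigenspace (A + B) (a + b)))%N.
Proof.
rewrite -mxrank_sum_cap leq_add ?rank_leq_col //.
apply/mxrankS/eigenspaceP.
have /eigenspaceP EA := capmxSl (eigenspace A a) (eigenspace B b).
have /eigenspaceP EB := capmxSr (eigenspace A a) (eigenspace B b).
by rewrite mulmxDr EA EB scalerDl.
Qed.

(** Column j of the equation v S = c v reads v_(j+1) = c v_j for every j but
    the last one; hence every row of an eigenspace is a multiple of
    (1, c, c^2, ...). *)
Lemma rank_eigenspace_companion (F : fieldType) (n : nat) (s : nat -> F)
    (c : F) :
  (\rank (eigenspace (companion_mx n s) c) <= 1)%N.
Proof.
case: n => [|n]; first exact: leq_trans (rank_leq_row _) _.
set E := eigenspace _ _.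
have /eigenspaceP ES := submx_refl E.
clearbody E.
have geom i j (lt_jn : (j < n.+1)%N) :
    E i (Ordinal lt_jn) = E i ord0 * c ^+ j.
  elim: j lt_jn => [|j IH] lt_jn.
    by rewrite expr0 mulr1; congr (E i _); apply: val_inj.
  have lt_j := ltnW lt_jn.
  have := congr1 (fun M : 'M_n.+1 => M i (Ordinal lt_j)) ES.
  rewrite !mxE (bigD1 (Ordinal lt_jn)) //= big1 => [|k neq_k].
    by rewrite !mxE /= eqxx (ltn_eqF lt_jn) mulr1 addr0 IH exprS mulrCA.
  by rewrite !mxE /= (ltn_eqF lt_jn) -val_eqE /= in neq_k *;
     rewrite (negPf neq_k) mulr0.
have -> : E = col ord0 E *m (\row_j c ^+ j).
  apply/matrixP => i [j lt_jn].
  by rewrite geom !mxE big_ord1 !mxE.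
exact: leq_trans (mxrankM_maxr _ _) (rank_leq_row _).
Qed.

Lemma orbit_diagonalizable (F : fieldType) (n : nat) (O : set 'M[F]_n)
    (A : 'M[F]_n) :
  semisimple_orbit O -> O A -> diagonalizable A.
Proof.
case=> X [P Pu dX] -> [Q Qu <-].
exists (P *m invmx Q); first by rewrite unitmx_mul Pu unitmx_inv.
have Qu' : invmx Q \in unitmx by rewrite unitmx_inv.
move: dX; rewrite /similar_to conjuMumx // (conjumx _ Qu') invmxK !mulmxA.
by rewrite mulVmx // mul1mx mulmxKV.
Qed.

Lemma orbit_large_eigenspace (F : fieldType) (n : nat) (O : set 'M[F]_n)
    (a b : F) (k l : nat) (A : 'M[F]_n) :
  semisimple_orbit O -> has_spectrum2 O a b k l -> O A ->
  exists c : F, (maxn k l <= \rank (eigenspace A c))%N.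
Proof.
move=> ssO [_ spec] OA; have [_ mup_a mup_b] := spec A OA.
have dA := orbit_diagonalizable ssO OA.
case: (leqP k l) => _; [exists b; rewrite -mup_b | exists a; rewrite -mup_a];
  exact: mup_char_poly_le_rank_eigenspace.
Qed.

Theorem proposition2p1 (R : realType) (n : nat) (O1 O2 : set 'M[R[i]]_n)
    (mu1 mu2 : R[i]) (k1 l1 k2 l2 : nat)
    (ssO1 : semisimple_orbit O1) (ssO2 : semisimple_orbit O2)
    (specO1 : has_spectrum2 O1 mu1 (- mu1) k1 l1)
    (specO2 : has_spectrum2 O2 mu2 (- mu2) k2 l2)
    (kl1 : (k1 + l1)%N = n) (kl2 : (k2 + l2)%N = n) :
  let d1 : int := k1%:Z - l1%:Z in
  let d2 : int := k2%:Z - l2%:Z in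
  `|d1| + `|d2| > 2 ->
  [set AB : 'M[R[i]]_n * 'M[R[i]]_n |
     (O1 `*` O2) AB /\ companion_set (AB.1 + AB.2)] = set0.
Proof.
move=> d1 d2 d_gt2; rewrite -subset0 => -[A B] /= [[/= OA OB] [s _ eqS]].
have [c1 rA] := orbit_large_eigenspace ssO1 specO1 OA.
have [c2 rB] := orbit_large_eigenspace ssO2 specO2 OB.
have dim_le : (maxn k1 l1 + maxn k2 l2 <= n + 1)%N.
  apply: leq_trans (leq_add rA rB) _.
  apply: leq_trans (rank_eigenspaceD _ _ _ _) _.
  by rewrite leq_add2l -eqS rank_eigenspace_companion.
by move: d_gt2; rewrite /d1 /d2; lia.
Qed.
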